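(* Let $K$ be a field and let $M\subseteq\mathbb{Z}^2$ be a two-dimensional (rank $2$) submodule, generated by the rows of $\begin{pmatrix}a_1 & a_2 \\ 0 & a_3\end{pmatrix}$ with $a_1>0$, $0\le a_2<a_3$, and hence also by the rows of $\begin{pmatrix}b_1 & b_2 \\ b_3 & 0\end{pmatrix}$ with $b_2>0$, $0\le b_1<b_3$. Let $I_M\subseteq K[x,y]$ be the corresponding lattice ideal. Then any maximal compatible order ideal w.r.t. $M$ corresponds to the order ideal constructed from a Gröbner basis of $I_M$ (and conversely). $I_M$ has two reduced Gröbner bases of two elements, which are $\{x^{a_1}-1,\ y^{a_3}-1\}$ and $\{x^{b_3}-1,\ y^{b_2}-1\}$, and all the other reduced Gröbner bases of $I_M$ have three elements, of the form $x^{\alpha}-y^{\alpha'}$, $y^{\beta}-x^{\beta'}$, $x^{\gamma_1}y^{\gamma_2}-1$, where $A=(\alpha,0)$, $A'=(0,\alpha')$, $B=(0,\beta)$, $B'=(\beta',0)$, $C=(\gamma_1,\gamma_2)$; here $A,B,C$ are the corners of a maximal compatible order ideal and $A',B'$ are the representatives (mod $M$) of $A$ and $B$ in that order ideal.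
   Context: $\mathbb{N}$ denotes the non-negative integers. The entries of the two matrices are related by $b_2=\gcd(a_2,a_3)$, $b_3=a_1a_3/b_2$ and $b_1=a_1\cdot\min\{\lambda\in\mathbb{N} \mid \exists\,\mu\in\mathbb{Z}:\ b_2=\lambda a_2+\mu a_3\}$. For $a\in\mathbb{Z}^2$, $a^+$ and $a^-$ have components $\max(a_i,0)$ and $\max(-a_i,0)$; writing $x^uy^v$ for the monomial of $(u,v)\in\mathbb{N}^2$, the lattice ideal $I_M$ is the ideal of $K[x,y]$ generated by the differences of the monomials of $a^+$ and $a^-$, for $a\in M$. An order ideal is a subset $\mathcal{O}\subseteq\mathbb{N}^2$ closed under passing to componentwise smaller elements of $\mathbb{N}^2$; it is identified with the set of monomials with exponents in $\mathcal{O}$. It is compatible (mod $M$) if $a,b\in\mathcal{O}$ and $a-b\in M$ imply $a=b$, and maximal compatible if it is compatible and maximal w.r.t. inclusion among compatible order ideals. The order ideal constructed from a Gröbner basis $G$ of $I_M$ (w.r.t. some term order) is the set of (exponents of) monomials irreducible w.r.t. $G$, i.e. not divisible by any leading monomial of an element of $G$. The corners of an order ideal $\mathcal{O}$ are the minimal elements of $\mathbb{N}^2\setminus\mathcal{O}$ w.r.t. the componentwise order. A representative (mod $M$) of $z$ in $\mathcal{O}$ is an element $w\in\mathcal{O}$ with $z-w\in M$.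
   Formalization: As printed, x^{a_1}-1 and y^{b_2}-1 are not in I_M when a_2>0 (e.g. a=(1,1,3)); they are replaced by x^{a_1}-y^{(a_3-a_2) mod a_3} and y^{b_2}-x^{(b_3-b_1) mod b_3}. The two bases coincide exactly when a_2=0, where the printed formulas hold. *)

(* Defs.v *)
From HB Require Import structures.
From mathcomp Require Import all_boot all_order all_algebra.
From mathcomp Require Import finmap mpoly.

Set Implicit Arguments.
Unset Strict Implicit.
Unset Printing Implicit Defensive.

Import Order.TTheory GRing.Theory Num.Theory.
Local Open Scope ring_scope.

(* Points of N^n are the exponent vectors 'X_{1..n}: (a <= b)%MM is the
   componentwise order on them, whereas (a <= b)%O is multinomials' built-in
   degree order, which plays no role here. *)

Section PolynomialIdeals.

Variables (n : nat) (K : fieldType).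

Implicit Types (S I : {mpoly K[n]} -> Prop) (p q g : {mpoly K[n]}).
Implicit Types (G : {fset {mpoly K[n]}}) (m l : 'X_{1..n}).

Definition ideal_gen S p : Prop :=
  exists s : seq ({mpoly K[n]} * {mpoly K[n]}),
    (forall c, c \in s -> S c.2) /\ p = \sum_(c <- s) c.1 * c.2.

(* Well-foundedness is not required separately: it follows from the other
   conditions by Dickson's lemma. *)
Definition term_order (le : rel 'X_{1..n}) : Prop :=
  [/\ total le, antisymmetric le, transitive le, (forall m, le 0%MM m)
    & (forall m m1 m2, le m1 m2 -> le (m + m1)%MM (m + m2)%MM)].

(* The zero polynomial has no leading monomial. *)
Definition leading_monomial (le : rel 'X_{1..n}) p m : Prop :=
  m \in msupp p /\ (forall m', m' \in msupp p -> le m' m).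

Definition initial_ideal (le : rel 'X_{1..n}) S : {mpoly K[n]} -> Prop :=
  ideal_gen (fun q => exists p m,
    [/\ S p, leading_monomial le p m & q = 'X_[m]]).

Definition groebner_basis (le : rel 'X_{1..n}) G I : Prop :=
  (forall g, g \in G -> I g) /\
  (forall p, initial_ideal le (fun g => g \in G) p <-> initial_ideal le I p).

Definition irreducible_monomial (le : rel 'X_{1..n}) G m : Prop :=
  forall g l, g \in G -> leading_monomial le g l -> ~~ (l <= m)%MM.

Definition reduced_groebner_basis (le : rel 'X_{1..n}) G I : Prop :=
  [/\ groebner_basis le G I,
      (forall g, g \in G -> exists m, leading_monomial le g m /\ g@_m = 1)
    & (forall g m, g \in G -> m \in msupp g ->
         irreducible_monomial le (G `\ g)%fset m)].

Definition is_reduced_groebner_basis G I : Prop :=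
  exists le : rel 'X_{1..n}, term_order le /\ reduced_groebner_basis le G I.

End PolynomialIdeals.

Section Lattices.

Variable n : nat.

Implicit Types (M : 'rV[int]_n -> Prop) (O : 'X_{1..n} -> Prop).
Implicit Types (a b m z w : 'X_{1..n}).

Definition zpoint m : 'rV[int]_n := \row_i (m i)%:Z.

Definition pos_part (v : 'rV[int]_n) : 'X_{1..n} :=
  [multinom absz (Num.max (v 0 i) 0)%R | i < n].

Definition neg_part (v : 'rV[int]_n) : 'X_{1..n} :=
  [multinom absz (Num.max (- v 0 i) 0)%R | i < n].

Definition lattice_ideal (K : fieldType) M : {mpoly K[n]} -> Prop :=
  ideal_gen (fun p => exists v, M v /\ p = 'X_[pos_part v] - 'X_[neg_part v]).

Definition order_ideal O : Prop :=
  forall a b, (a <= b)%MM -> O b -> O a.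

Definition compatible M O : Prop :=
  forall a b, O a -> O b -> M (zpoint a - zpoint b) -> a = b.

Definition maximal_compatible M O : Prop :=
  [/\ order_ideal O, compatible M O
    & (forall O' : 'X_{1..n} -> Prop, order_ideal O' -> compatible M O' ->
         (forall m, O m -> O' m) -> (forall m, O' m -> O m))].

Definition corner O m : Prop :=
  ~ O m /\ (forall m', ~ O m' -> (m' <= m)%MM -> m' = m).

Definition representative M O z w : Prop :=
  O w /\ M (zpoint z - zpoint w).

End Lattices.

Definition zvec (u v : int) : 'rV[int]_2 := \row_i [:: u; v]`_i.

Definition npoint (u v : nat) : 'X_{1..2} := [multinom nth 0%N [:: u; v] i | i < 2].

Definition monomial (K : fieldType) (u v : nat) : {mpoly K[2]} := 'X_[npoint u v].

Definition is_least (P : nat -> Prop) (k : nat) : Prop :=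
  P k /\ (forall j, P j -> (k <= j)%N).

(* Main.v *)
Require Import Defs.
From HB Require Import structures.
From mathcomp Require Import all_boot all_order all_algebra.
From mathcomp Require Import finmap ssrcomplements mpoly bigenough.
From Stdlib Require Import ClassicalEpsilon FunctionalExtensionality PropExtensionality.
From mathcomp Require Import zify ring.

Set Implicit Arguments.
Unset Strict Implicit.
Unset Printing Implicit Defensive.

Import Order.TTheory GRing.Theory Num.Theory BigEnough.
Local Open Scope ring_scope.

(** Call a point of N^n standard for a term order when it is the smallest
    element of its class modulo M. The lattice ideal is spanned by the binomials
    x^a - x^b with a - b in M, and every function on N^n that is constant on
    the classes modulo M gives a linear functional killing it. Hence a nonzero
    element of the ideal always has two monomials in one class, and its leading
    monomial is not standard; conversely a nonstandard point is the leading
    monomial of a binomial of the ideal. So the irreducible monomials of any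
    Groebner basis are the standard points ([irreducible_monomialP]), and the
    reduced Groebner basis consists of the binomials x^c - x^r, where c runs over
    the corners of the set of standard points and r is the standard
    representative of c ([reduced_groebner_basisP]). The standard points contain
    exactly one point of each class, so that they form a maximal compatible
    order ideal.

    Conversely let O be a maximal compatible order ideal in the plane. A corner
    c of O cannot be added to O, so c has a representative r in O, and c, r have
    disjoint supports because O is compatible. Thus the corner A = (a, 0) is
    congruent to some A' = (0, a'), the corner B = (0, b) to some B' = (b', 0),
    and every other corner lies in M; moreover a' < b and b' < a. Because of
    a' b' < a b, the weight (b + a', a + b') makes A heavier than A' and B heavier
    than B'. Every point outside O then has a lighter point in its class, so
    the standard points for that weight lie in O, and O being compatible they
    exhaust it ([weight_standard], [maximal_compatible_standard]).

    The shape of the reduced bases is the shape of the set of corners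
    ([saturated_corners]): two corners off the axes would differ by an element
    of M that identifies two points of O on different axes, so there are two or
    three corners. With only A and B, the point (a - b', b - a') would lie in
    O and be congruent to 0 unless a' = 0 or b' = 0. Then (a, 0) or (0, b)
    lies in M, and the box [0, a) x [0, b) meets each class only once; comparing
    with the two triangular bases of M leaves one box for each of the two
    cases ([two_corners_unique]). *)

(** * Ideals generated by monomials, and initial ideals *)

Section IdealGen.

Variables (n : nat) (K : fieldType).
Implicit Types (S T : {mpoly K[n]} -> Prop) (p q g : {mpoly K[n]}).
Implicit Types (m l : 'X_{1..n}).

Lemma ideal_gen_incl S p : S p -> ideal_gen S p.
Proof.
move=> Sp; exists [:: (1, p)]; split; last by rewrite big_seq1 mul1r.
by move=> c; rewrite inE => /eqP ->.
Qed.

Lemma ideal_gen0 S : ideal_gen S 0.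
Proof. by exists [::]; split=> //; rewrite big_nil. Qed.

Lemma ideal_genD S p q : ideal_gen S p -> ideal_gen S q -> ideal_gen S (p + q).
Proof.
move=> [s [Ss ->]] [t [St ->]]; exists (s ++ t); split; last by rewrite big_cat.
by move=> c; rewrite mem_cat => /orP[/Ss|/St].
Qed.

Lemma ideal_genMl S p q : ideal_gen S q -> ideal_gen S (p * q).
Proof.
move=> [s [Ss ->]]; exists [seq (p * c.1, c.2) | c <- s]; split.
  by move=> _ /mapP[c cs ->] /=; exact: Ss.
by rewrite big_map mulr_sumr; apply: eq_bigr => c _; rewrite mulrA.
Qed.

Lemma ideal_genB S p q : ideal_gen S p -> ideal_gen S q -> ideal_gen S (p - q).
Proof.
by move=> Sp Sq; apply: ideal_genD => //; rewrite -mulN1r; apply: ideal_genMl.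
Qed.

Lemma ideal_gen_sub S T p :
  (forall q, S q -> ideal_gen T q) -> ideal_gen S p -> ideal_gen T p.
Proof.
move=> ST [s [Ss ->]]; elim: s Ss => [|c s IHs] Ss.
  by rewrite big_nil; exact: ideal_gen0.
rewrite big_cons; apply: ideal_genD.
  by apply/ideal_genMl/ST/Ss; rewrite mem_head.
by apply: IHs => d ds; apply: Ss; rewrite inE ds orbT.
Qed.

(** A monomial occurring in a sum of multiples of generators already occurs in
    one of the summands. *)
Lemma ideal_gen_monomial (P : 'X_{1..n} -> Prop) m :
  ideal_gen (fun q : {mpoly K[n]} => exists2 l, P l & q = 'X_[l]) 'X_[m] <->
  exists2 l, P l & (l <= m)%MM.
Proof.
split=> [[s [Ss Xm]]|[l Pl lm]]; last first.
  rewrite -(submK lm) mpolyXD; apply: ideal_genMl.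
  by apply: ideal_gen_incl; exists l.
have: m \in msupp ('X_[m] : {mpoly K[n]}) by rewrite msuppX mem_head.
rewrite Xm => /msupp_sum_le /flatten_mapP[c]; rewrite filter_predT => cs.
have [l Pl ->] := Ss c cs.
rewrite (perm_mem (msuppMX _ _)) => /mapP[k _ ->].
by exists l => //; exact: lem_addr.
Qed.

End IdealGen.

Section TermOrder.

Variables (n : nat) (K : fieldType) (le : rel 'X_{1..n}).
Hypothesis leT : term_order le.
Implicit Types (p q g : {mpoly K[n]}) (m l : 'X_{1..n}) (O : 'X_{1..n} -> Prop).
Implicit Types (G : {fset {mpoly K[n]}}) (I : {mpoly K[n]} -> Prop).

Lemma term_order_refl m : le m m.
Proof. by case: leT => tot _ _ _ _; have := tot m m; rewrite orbb. Qed.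

Lemma term_order_lepm l m : (l <= m)%MM -> le l m.
Proof.
case: leT => _ _ _ le0 leD lm.
by rewrite -(submK lm) addmC -{1}[l]addm0; apply: leD.
Qed.

Lemma leading_monomial_inj p m l :
  leading_monomial le p m -> leading_monomial le p l -> m = l.
Proof.
case: leT => _ anti _ _ _ [mp pm] [lp pl].
by apply: anti; rewrite pl ?pm.
Qed.

Lemma leading_monomial_binomial m l :
  le l m -> l != m -> leading_monomial le ('X_[K, m] - 'X_[l]) m.
Proof.
move=> lm lneq; split.
  rewrite mcoeff_msupp mcoeffB !mcoeffX eqxx (negbTE lneq) subr0.
  exact: oner_neq0.
move=> k /msuppB_le; rewrite !msuppX mem_cat !inE => /orP[] /eqP -> //.
exact: term_order_refl.
Qed.

Lemma initial_idealE I p :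
  initial_ideal le I p <->
  ideal_gen (fun q => exists2 m, (exists2 g, I g & leading_monomial le g m)
                               & q = 'X_[m]) p.
Proof.
split; apply: ideal_gen_sub => q.
  by move=> [g [m [Ig gm ->]]]; apply: ideal_gen_incl; exists m => //; exists g.
by move=> [m [g Ig gm] ->]; apply: ideal_gen_incl; exists g, m.
Qed.

Lemma monomial_in_initial_ideal I m :
  initial_ideal le I 'X_[m] <->
  exists g l, [/\ I g, leading_monomial le g l & (l <= m)%MM].
Proof.
rewrite initial_idealE ideal_gen_monomial; split.
  by move=> [l [g Ig gl] lm]; exists g, l.
by move=> [g [l [Ig gl lm]]]; exists l => //; exists g.
Qed.

(** Both initial ideals are generated by monomials, so they can be compared
    on the leading monomials of the elements of [I]. *)
Lemma groebner_basisP G I :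
  groebner_basis le G I <->
  (forall g, g \in G -> I g) /\
  (forall p m, I p -> leading_monomial le p m ->
     exists g l, [/\ g \in G, leading_monomial le g l & (l <= m)%MM]).
Proof.
split=> [[GI inG]|[GI lmG]]; split=> //.
  move=> p m Ip pm; apply/monomial_in_initial_ideal/inG.
  by apply/monomial_in_initial_ideal; exists p, m; split=> //; exact: lepm_refl.
move=> p; split; apply: ideal_gen_sub => q [g [m [Gg gm ->]]].
  by apply: ideal_gen_incl; exists g, m; split=> //; exact: GI.
exact/monomial_in_initial_ideal/lmG/gm.
Qed.

End TermOrder.

(** * Corners of order ideals *)

Section Corners.

Variable n : nat.
Implicit Types (M : 'rV[int]_n -> Prop) (O : 'X_{1..n} -> Prop).
Implicit Types (m c r : 'X_{1..n}).

(** The componentwise order is well founded because the degree is strictly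
    monotone for it. *)
Lemma corner_below O m : ~ O m -> exists2 c, corner O c & (c <= m)%MM.
Proof.
have [k] := ubnP (mdeg m); elim: k m => // k IHk m mk Om.
case: (classic (corner O m)) => [cm|ncm]; first by exists m => //; exact: lepm_refl.
have [m' [Om' m'm m'neq]] : exists m', [/\ ~ O m', (m' <= m)%MM & m' <> m].
  apply: NNPP => no; apply: ncm; split=> // m' Om' m'm.
  by apply: NNPP => m'neq; apply: no; exists m'.
have [|//|c cc cm'] := IHk m'; last by exists c => //; exact: lepm_trans m'm.
rewrite -(submK m'm) mdegD in mk.
have : mdeg (m - m') != 0%N.
  rewrite mdeg_eq0; apply/eqP => eq0; apply: m'neq.
  by rewrite -(submK m'm) eq0 add0m.
by rewrite -lt0n; lia.
Qed.

Lemma corner_pred O c m :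
  corner O c -> (m <= c)%MM -> m != c -> O m.
Proof.
by move=> [_ minc] mc /eqP mneq; apply: NNPP => Om; apply/mneq/minc.
Qed.

End Corners.

(** * Lattice ideals and standard monomials *)

Section LatticeIdeal.

Variables (n : nat) (K : fieldType) (M : 'rV[int]_n -> Prop).
Hypothesis M0 : M 0.
Hypothesis MB : forall u v, M u -> M v -> M (u - v).
Implicit Types (p q g : {mpoly K[n]}) (a b c d m l r : 'X_{1..n}).
Implicit Types (O : 'X_{1..n} -> Prop) (G : {fset {mpoly K[n]}}).

Local Notation I := (lattice_ideal (K := K) M).

Definition congruent a b := M (zpoint a - zpoint b).

Lemma latticeN u : M u -> M (- u).
Proof. by move=> Mu; rewrite -sub0r; apply: MB. Qed.

Lemma latticeD u v : M u -> M v -> M (u + v).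
Proof. by move=> Mu Mv; rewrite -[v]opprK; apply/MB/latticeN. Qed.

Lemma zpointD a b : zpoint (a + b) = zpoint a + zpoint b.
Proof. by apply/rowP => i; rewrite !mxE mnmDE PoszD. Qed.

Lemma congruent_refl a : congruent a a.
Proof. by rewrite /congruent subrr. Qed.

Lemma congruent_sym a b : congruent a b -> congruent b a.
Proof. by move=> /latticeN; rewrite opprB. Qed.

Lemma congruent_trans b a c : congruent a b -> congruent b c -> congruent a c.
Proof.
by move=> ab bc; have := latticeD ab bc; rewrite addrA subrK.
Qed.

Lemma congruentD2r k a b : congruent (a + k) (b + k) <-> congruent a b.
Proof. by rewrite /congruent !zpointD opprD addrACA subrr addr0. Qed.

Lemma congruent_subm k a b : (k <= a)%MM -> (k <= b)%MM ->
  congruent a b -> congruent (a - k) (b - k).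
Proof. by move=> ka kb ab; apply/(congruentD2r k); rewrite !submK. Qed.

(** The positive and negative parts of [a - b] are what is left of [a] and [b]
    once their componentwise minimum is removed. *)
Lemma congruent_binomial a b : congruent a b -> I ('X_[a] - 'X_[b]).
Proof.
move=> ab; pose k : 'X_{1..n} := [multinom minn (a i) (b i) | i < n].
pose v := zpoint a - zpoint b.
have aE : a = (k + pos_part v)%MM by apply/mnmP => i; rewrite mnmDE !mnmE !mxE; lia.
have bE : b = (k + neg_part v)%MM by apply/mnmP => i; rewrite mnmDE !mnmE !mxE; lia.
rewrite {1}aE {1}bE !mpolyXD -mulrBr; apply/ideal_genMl/ideal_gen_incl.
by exists v.
Qed.

Definition weighted_sum (f : 'X_{1..n} -> K) p := \sum_(m <- msupp p) p@_m * f m.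

Lemma weighted_sumE f p k : (msize p <= k)%N ->
  weighted_sum f p = \sum_(m : 'X_{1..n < k}) p@_m * f m.
Proof.
move=> pk; pose J : subFinType _ := 'X_{1..n < k}.
rewrite /weighted_sum (big_mksub J) ?msupp_uniq //=; last first.
  by move=> x /msize_mdeg_lt /leq_trans; apply.
by rewrite big_rmcond //= => j /memN_msupp_eq0 ->; rewrite mul0r.
Qed.

Lemma weighted_sum_is_additive f : additive (weighted_sum f).
Proof.
move=> p q /=; pose_big_enough k.
  rewrite !(@weighted_sumE f _ k) // -sumrB; apply/eq_bigr => m _.
  by rewrite mcoeffB mulrBl.
by close.
Qed.

HB.instance Definition _ f :=
  GRing.isAdditive.Build {mpoly K[n]} K (weighted_sum f)
    (weighted_sum_is_additive f).

Lemma weighted_sumZX f x m : weighted_sum f (x *: 'X_[m]) = x * f m.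
Proof.
have [->|x0] := eqVneq x 0; first by rewrite scale0r raddf0 mul0r.
rewrite /weighted_sum msuppMCX // big_seq1.
by rewrite mcoeffZ mcoeffX eqxx mulr1.
Qed.

(** A product of a monomial with a generator of the ideal is a difference of
    two congruent monomials, at which the weights cancel. *)
Lemma lattice_ideal_weighted_sum f p :
  (forall a b, congruent a b -> f a = f b) -> I p -> weighted_sum f p = 0.
Proof.
move=> fM [s [Is ->]]; rewrite raddf_sum big_seq big1 // => -[q g] /= qs.
have [v [Mv /= ->]] := Is _ qs.
rewrite [q]mpolyE mulr_suml raddf_sum big1 // => m _.
rewrite mulrBr raddfB /= -!scalerAl -!mpolyXD !weighted_sumZX.
rewrite (fM _ (m + neg_part v)%MM) ?subrr //.
rewrite ![(m + _)%MM]addmC; apply/congruentD2r.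
rewrite /congruent; suff -> : zpoint (pos_part v) - zpoint (neg_part v) = v by [].
by apply/rowP => i; rewrite !mxE !mnmE; case: (v 0 i) => k; lia.
Qed.

(** The functional summing the coefficients over the class of [m] vanishes on
    the ideal, so a coefficient at [m] must be compensated inside that class. *)
Lemma lattice_ideal_partner p m : I p -> m \in msupp p ->
  exists2 l, l \in msupp p & l != m /\ congruent l m.
Proof.
move=> Ip mp.
pose f l : K := if excluded_middle_informative (congruent l m) then 1 else 0.
have fM a b : congruent a b -> f a = f b.
  move=> ab; rewrite /f.
  case: excluded_middle_informative => am; case: excluded_middle_informative => bm //.
    by case: bm; exact: congruent_trans (congruent_sym ab) am.
  by case: am; exact: congruent_trans ab bm.
have := lattice_ideal_weighted_sum fM Ip.
rewrite /weighted_sum (bigD1_seq m) ?msupp_uniq //= => sum0.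
apply: NNPP => no; move: sum0; rewrite big_seq_cond big1 => [|l /andP[lp lm]].
  rewrite addr0 /f; case: excluded_middle_informative => [mm|nmm]; last first.
    by case: nmm; exact: congruent_refl.
  by rewrite mulr1 => /eqP; apply/negP; rewrite -mcoeff_msupp.
rewrite /f; case: excluded_middle_informative => [lcm|nlm]; last by rewrite mulr0.
by case: no; exists l.
Qed.

Lemma lattice_ideal_compatible p O : compatible M O -> I p ->
  (forall m, m \in msupp p -> O m) -> p = 0.
Proof.
move=> compO Ip pO; apply/eqP/negPn/negP; rewrite -msupp_eq0.
case E: (msupp p) => [//|m s] _.
have mp : m \in msupp p by rewrite E mem_head.
have [l lp [/eqP lm lcm]] := lattice_ideal_partner Ip mp.
by apply/lm/compO/lcm; exact: pO.
Qed.

Section Standard.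

Variable le : rel 'X_{1..n}.
Hypothesis leT : term_order le.

Definition standard m := forall l, congruent m l -> le m l.

(** A congruent point below [a] would, translated by [b - a], be a congruent point
    below [b]. *)
Lemma standard_order_ideal : order_ideal standard.
Proof.
case: (leT) => tot anti _ _ leD a b ab; rewrite -(submK ab).
move: (b - a)%MM => k sb l al.
have kl : le (k + a)%MM (k + l)%MM.
  by apply: sb; rewrite ![(k + _)%MM]addmC; exact/congruentD2r.
have [//|nal] := boolP (le a l).
have la : le l a by have := tot a l; rewrite (negbTE nal).
have /addmI al' : (k + a = k + l)%MM by apply: anti; rewrite kl leD.
by rewrite al' term_order_refl in nal.
Qed.

Lemma standard_compatible : compatible M standard.
Proof.
case: (leT) => tot anti tr le0 leD a b sa sb ab.
by apply: anti; rewrite sa ?sb //; exact: congruent_sym.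
Qed.

Lemma nonstandard_smaller m : ~ standard m ->
  exists2 l, congruent m l & le l m && (l != m).
Proof.
case: (leT) => tot _ _ _ _ nst; apply: NNPP => no; apply: nst => l ml.
have [//|nml] := boolP (le m l); case: no; exists l => //.
have := tot m l; rewrite (negbTE nml) => /= ->.
by apply/eqP => lm; rewrite lm term_order_refl in nml.
Qed.

(** The leading monomial has a congruent partner in the support, which is
    smaller. *)
Lemma leading_monomial_nonstandard p m :
  I p -> leading_monomial le p m -> ~ standard m.
Proof.
case: (leT) => tot anti tr le0 leD Ip [mp pm] stm.
have [l lp [/eqP lm lcm]] := lattice_ideal_partner Ip mp.
by apply/lm/anti; rewrite pm //=; apply/stm/congruent_sym.
Qed.

(** The nonstandard points are exactly the leading monomials of elements of
    the ideal: each one leads a binomial whose other term is a smaller point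
    of its class. *)
Lemma lattice_groebner_basisP G :
  groebner_basis le G I <->
  (forall g, g \in G -> I g) /\
  (forall m, ~ standard m ->
     exists g l, [/\ g \in G, leading_monomial le g l & (l <= m)%MM]).
Proof.
rewrite groebner_basisP //; split=> -[GI Glm]; split=> //.
  move=> m /nonstandard_smaller[l ml /andP[lm lneq]].
  apply: Glm (leading_monomial_binomial K leT lm lneq).
  exact: congruent_binomial.
move=> p m Ip /(leading_monomial_nonstandard Ip); exact: Glm.
Qed.

Lemma irreducible_monomialP G m :
  groebner_basis le G I -> irreducible_monomial le G m <-> standard m.
Proof.
move=> /lattice_groebner_basisP[GI Glm]; split=> [irr|stm g l Gg gl].
  apply: NNPP => /Glm[g [l [Gg gl lm]]].
  by have := irr g l Gg gl; rewrite lm.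
apply/negP => lm; apply: (leading_monomial_nonstandard (GI _ Gg) gl).
exact: standard_order_ideal stm.
Qed.

Hypothesis standardP : forall m, exists2 r, standard r & congruent m r.

Lemma standard_maximal_compatible : maximal_compatible M standard.
Proof.
split=> [||O ordO compO sub m Om]; first exact: standard_order_ideal.
  exact: standard_compatible.
have [r str mr] := standardP m.
by rewrite (compO _ _ Om (sub _ str) mr).
Qed.

Lemma nonstandard_lt m r : ~ standard m -> standard r -> congruent m r ->
  le r m /\ r != m.
Proof.
move=> nst str mr; split; first exact/str/congruent_sym.
by apply/eqP => rm; apply: nst; rewrite -rm.
Qed.

(** In a reduced basis every leading monomial is a corner, since a smaller
    nonstandard point would be divisible by another leading monomial. All the
    other monomials of an element are standard; after subtracting the binomial
    of its corner, an element of the ideal with standard support remains, and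
    such an element is zero. *)
Lemma reduced_groebner_basisP G :
  reduced_groebner_basis le G I <->
  (forall g, g \in G <-> exists c r,
     [/\ corner standard c, standard r, congruent c r & g = 'X_[c] - 'X_[r]]).
Proof.
have lmB c r : corner standard c -> standard r -> congruent c r ->
    leading_monomial le ('X_[K, c] - 'X_[r]) c.
  move=> [nc _] str cr.
  by have [rc rneq] := nonstandard_lt nc str cr; exact: leading_monomial_binomial.
split=> [[gbG monG redG]|GP].
- have irrP := fun m => irreducible_monomialP m gbG.
  have [GI Glm] := (lattice_groebner_basisP G).1 gbG.
  have lm_corner g c : g \in G -> leading_monomial le g c -> corner standard c.
    move=> Gg gc; split=> [|l nstl lc].
      exact: leading_monomial_nonstandard (GI _ Gg) gc.
    have [h [k [Gh hk kl]]] := Glm _ nstl.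
    have kc := lepm_trans kl lc.
    have hg : h = g.
      apply/eqP/negPn/negP => hneq.
      have := redG g c Gg gc.1 h k; rewrite !inE hneq Gh kc.
      by move=> /(_ isT hk).
    rewrite hg in hk; have ck := leading_monomial_inj leT gc hk.
    apply/mnmP => i; apply/eqP; rewrite eqn_leq.
    by rewrite (mnm_lepP lc) (mnm_lepP _ i) // ck.
  (* the difference of [g] and its binomial is an element of the ideal with
     standard support *)
  have binomG g c r : g \in G -> leading_monomial le g c ->
      standard r -> congruent c r -> g = 'X_[c] - 'X_[r].
    move=> Gg gc str cr; apply/subr0_eq.
    apply: (lattice_ideal_compatible standard_compatible).
      by apply: ideal_genB; [exact: GI | exact: congruent_binomial].
    have [c' [gc' gc1]] := monG g Gg.
    rewrite (leading_monomial_inj leT gc' gc) in gc1.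
    have [nc _] := lm_corner g c Gg gc.
    move=> m mh.
    have mc : m != c.
      apply: contraL mh => /eqP ->; rewrite mcoeff_msupp !mcoeffB !mcoeffX eqxx gc1.
      have [_ /negbTE ->] := nonstandard_lt nc str cr.
      by rewrite subr0 subrr negbK.
    move: mh => /msuppB_le; rewrite mem_cat => /orP[mg|]; last first.
      move=> /msuppB_le; rewrite !msuppX mem_cat !inE (negbTE mc) /=.
      by move=> /eqP ->.
    apply/irrP => h k Gh hk.
    have [hg|hneq] := eqVneq h g; last first.
      by apply: (redG g m Gg mg h k); rewrite // !inE hneq.
    rewrite hg in hk; rewrite -(leading_monomial_inj leT gc hk).
    apply/negP => /(term_order_lepm leT) cm.
    case: (leT) => _ anti _ _ _; move/eqP: mc; apply.
    by apply: anti; rewrite cm gc.2.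
  move=> g; split=> [Gg|[c [r [cc str cr ->]]]].
    have [c [gc _]] := monG g Gg; have [r str cr] := standardP c.
    exists c, r; split=> //; first exact: lm_corner gc.
    exact: binomG.
  have [h [k [Gh hk kc]]] := Glm c cc.1.
  have kE : k = c := cc.2 _ (lm_corner h k Gh hk).1 kc.
  by rewrite -(binomG h c r Gh) // -kE.
- split.
  + apply/lattice_groebner_basisP; split=> [g /GP[c [r [_ _ cr ->]]]|m].
      exact: congruent_binomial.
    move=> /corner_below[c cc cm]; have [r str cr] := standardP c.
    exists ('X_[c] - 'X_[r]), c; split=> //; last exact: lmB.
    by apply/GP; exists c, r.
  + move=> g /GP[c [r [cc str cr ->]]]; exists c; split; first exact: lmB.
    have [_ /negbTE rc] := nonstandard_lt cc.1 str cr.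
    by rewrite mcoeffB !mcoeffX eqxx rc subr0.
  + move=> g m /GP[c [r [cc str cr ->]]] mg h k.
    rewrite !inE => /andP[hneq /GP[d [s [cd std ds hE]]]] hk.
    rewrite hE in hk; rewrite (leading_monomial_inj leT hk (lmB _ _ cd std ds)).
    have rs : c = d -> h = 'X_[c] - 'X_[r].
      move=> cE; rewrite hE -cE; congr (_ - 'X_[_]).
      apply: standard_compatible => //; rewrite cE in cr.
      exact: congruent_trans (congruent_sym ds) cr.
    apply/negP => dm; move: mg => /msuppB_le.
    rewrite !msuppX mem_cat !inE => /orP[]/eqP mE; rewrite mE in dm.
      have dc : d = c := cc.2 _ cd.1 dm.
      by move/eqP: hneq; apply; rewrite rs.
    by apply: cd.1; apply: standard_order_ideal dm str.
Qed.

End Standard.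

(** Subtracting a common unit vector from [c] and [r] would give two distinct
    congruent elements of [O]. *)
Lemma corner_representative_disjoint O c r i :
  order_ideal O -> compatible M O -> corner O c -> O r -> congruent c r ->
  c i = 0%N \/ r i = 0%N.
Proof.
move=> ordO compO cc Or cr; apply: NNPP => /not_or_and[/eqP ci /eqP ri].
have Uc : (U_(i) <= c)%MM by rewrite lep1mP.
have Ur : (U_(i) <= r)%MM by rewrite lep1mP.
suff rc : c = r by apply: cc.1; rewrite rc.
rewrite -(submK Uc) -(submK Ur); congr (_ + _)%MM; apply: compO.
- apply: corner_pred cc _ _; first exact: lem_subr.
  apply/eqP => /mnmP /(_ i); rewrite mnmBE mnm1E eqxx; lia.
- exact: ordO (lem_subr _ _) Or.
- exact: congruent_subm.
Qed.

(** Adjoining a corner gives an order ideal again, so maximality makes it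
    incompatible, and a coincidence modulo [M] has to involve the corner. *)
Lemma maximal_compatible_saturated O c : maximal_compatible M O ->
  corner O c -> exists2 r, O r & congruent c r.
Proof.
move=> [ordO compO maxO] cc; apply: NNPP => no; apply: cc.1.
apply: (maxO (fun m => O m \/ m = c)); last by right.
- move=> a b ab [Ob|bE]; first by left; exact: ordO Ob.
  have [->|ac] := eqVneq a c; first by right.
  by left; apply: corner_pred cc _ ac; rewrite -bE.
- move=> a b [Oa|->] [Ob|->] // ab; first exact: compO.
    by case: no; exists a => //; exact: congruent_sym.
  by case: no; exists b.
- by move=> m; left.
Qed.

(** A binomial remembers its corner as its only monomial outside [O]. *)
Lemma corner_binomial_inj O c d r s : O r -> O s -> ~ O c -> ~ O d ->
  'X_[K, c] - 'X_[r] = 'X_[d] - 'X_[s] -> c = d.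
Proof.
move=> Or Os nc nd /(congr1 (mcoeff c)); rewrite !mcoeffB !mcoeffX eqxx.
have /negbTE -> : r != c by apply: contra_notN nc => /eqP <-.
have /negbTE -> : s != c by apply: contra_notN nc => /eqP <-.
rewrite !subr0; case: eqP => [//|_ /eqP].
by rewrite oner_eq0.
Qed.

End LatticeIdeal.

Lemma mem_seq_fset2 (T : choiceType) (x y z : T) :
  (z \in [:: x; y]) = (z \in [fset x; y]%fset).
Proof. by rewrite !inE. Qed.

Lemma mem_seq_fset3 (T : choiceType) (x y t z : T) :
  (z \in [:: x; y; t]) = (z \in [fset x; y; t]%fset).
Proof. by rewrite !inE orbA. Qed.

Lemma corner_ext n (O O' : 'X_{1..n} -> Prop) c :
  (forall m, O m <-> O' m) -> corner O c <-> corner O' c.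
Proof.
move=> OO'; split=> -[nc minc]; split=> [/OO' //|m nm]; apply: minc => /OO' //.
Qed.

Lemma corner_antichain n (O : 'X_{1..n} -> Prop) c d :
  corner O c -> corner O d -> (c <= d)%MM -> c = d.
Proof. by move=> [nc _] [_ mind]; exact: mind. Qed.

Lemma reduced_groebner_basis_corners n (K : fieldType) (M : 'rV[int]_n -> Prop)
    (le : rel 'X_{1..n}) (s : seq ('X_{1..n} * 'X_{1..n}))
    (G : {fset {mpoly K[n]}}) :
  M 0 -> (forall u v, M u -> M v -> M (u - v)) -> term_order le ->
  (forall m, exists2 r, standard M le r & congruent M m r) ->
  (forall c, corner (standard M le) c <-> c \in [seq x.1 | x <- s]) ->
  (forall x, x \in s -> standard M le x.2 /\ congruent M x.1 x.2) ->
  reduced_groebner_basis le G (lattice_ideal (K := K) M) <->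
  G =i [seq 'X_[x.1] - 'X_[x.2] | x <- s].
Proof.
move=> M0 MB leT stdP cs sP; rewrite reduced_groebner_basisP //.
have sE g : g \in [seq 'X_[K, x.1] - 'X_[x.2] | x <- s] <-> exists c r,
    [/\ corner (standard M le) c, standard M le r, congruent M c r
      & g = 'X_[c] - 'X_[r]].
  split=> [/mapP[x xs ->]|[c [r [/cs/mapP[x xs ->] str cr ->]]]].
    have [str cr] := sP x xs.
    by exists x.1, x.2; split=> //; apply/cs/map_f.
  have [str' cr'] := sP x xs; apply/mapP; exists x => //.
  congr (_ - 'X_[_]); apply: (standard_compatible M0 MB leT) => //.
  exact: (congruent_trans M0 MB (congruent_sym M0 MB cr) cr').
split=> GE g; last by rewrite -sE GE.
by apply/idP/idP => [/GE /sE|/sE /GE].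
Qed.

(** * Points and lattices in the plane *)

Section Plane.

Implicit Types (O : 'X_{1..2} -> Prop) (m : 'X_{1..2}).

Lemma npointE u v : (npoint u v ord0 = u) * (npoint u v ord_max = v).
Proof. by rewrite !mnmE. Qed.

Lemma npoint_coord m : m = npoint (m ord0) (m ord_max).
Proof.
apply/mnmP => i; rewrite mnmE.
by case: i => [[|[|//]] lti] /=; congr (m _); apply: val_inj.
Qed.

Lemma npoint_inj u v u' v' : npoint u v = npoint u' v' -> u = u' /\ v = v'.
Proof.
by move=> E; split; [have := congr1 (fun m => m ord0) E
                    | have := congr1 (fun m => m ord_max) E]; rewrite !npointE.
Qed.

Lemma npoint_eq u v u' v' :
  (npoint u v == npoint u' v') = (u == u') && (v == v').
Proof. by apply/eqP/andP => [/npoint_inj[-> ->]|[/eqP -> /eqP ->]]. Qed.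

Lemma npoint_le u v u' v' :
  (npoint u v <= npoint u' v')%MM = (u <= u')%N && (v <= v')%N.
Proof.
apply/mnm_lepP/andP => [le|[leu lev] i].
  by have := le ord0; have := le ord_max; rewrite !npointE.
by case: i => [[|[|//]] lti]; rewrite !mnmE.
Qed.

Lemma npoint0 : npoint 0 0 = 0%MM.
Proof. by apply/mnmP => -[[|[|//]] lti]; rewrite !mnmE. Qed.

Lemma monomial00 (K : fieldType) : monomial K 0 0 = 1.
Proof. by rewrite /monomial npoint0 mpolyX0. Qed.

Lemma zvecB u v u' v' : zvec u v - zvec u' v' = zvec (u - u') (v - v').
Proof. by apply/rowP => -[[|[|//]] lti]; rewrite !mxE. Qed.

Lemma zvecD u v u' v' : zvec u v + zvec u' v' = zvec (u + u') (v + v').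
Proof. by apply/rowP => -[[|[|//]] lti]; rewrite !mxE. Qed.

Lemma zvec_inj u v u' v' : zvec u v = zvec u' v' -> u = u' /\ v = v'.
Proof. by move=> /rowP E; have := E ord_max; have := E ord0; rewrite !mxE. Qed.

Lemma zvec_coord (w : 'rV[int]_2) : w = zvec (w 0 ord0) (w 0 ord_max).
Proof.
apply/rowP => i; rewrite mxE.
by case: i => [[|[|//]] lti] /=; congr (w _ _); apply: val_inj.
Qed.

Variable M : 'rV[int]_2 -> Prop.
Hypothesis M0 : M 0.
Hypothesis MB : forall u v, M u -> M v -> M (u - v).

Lemma congruent_npoint a b c d :
  congruent M (npoint a b) (npoint c d) = M (zvec (a%:Z - c%:Z) (b%:Z - d%:Z)).
Proof.
rewrite /congruent; congr M.
by apply/rowP => -[[|[|//]] lti]; rewrite !mxE !mnmE.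
Qed.

Lemma zvec_congr u v u' v' : M (zvec u v) -> u' = u -> v' = v -> M (zvec u' v').
Proof. by move=> Muv -> ->. Qed.

(** The disjunction always holds for the representatives (0, a') and (b', 0) of
    the two corners of a compatible order ideal. *)
Definition two_corners O a a' b b' :=
  (forall m, corner O m <-> m \in [:: npoint a 0; npoint 0 b]) /\
  (a' = 0%N \/ b' = 0%N).

Definition three_corners O a b := exists c1 c2 : nat,
  [/\ (0 < c1)%N, (0 < c2)%N, congruent M (npoint c1 c2) (npoint 0 0)
    & forall m, corner O m <-> m \in [:: npoint a 0; npoint 0 b; npoint c1 c2]].

(** The positive and negative parts of a vector of the box are two points of
    [O]. *)
Lemma two_corners_box O a a' b b' :
  compatible M O -> two_corners O a a' b b' ->
  forall x y : int, `|x| < a%:Z -> `|y| < b%:Z -> M (zvec x y) -> x = 0 /\ y = 0.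
Proof.
move=> compO [cornE _] x y xa yb xyM.
have boxO u v : (u < a)%N -> (v < b)%N -> O (npoint u v).
  move=> ua vb; apply: NNPP => /corner_below[c /cornE].
  by rewrite !inE => /orP[]/eqP ->; rewrite npoint_le; lia.
pose pos (z : int) := absz (Num.max z 0).
have /npoint_inj[] : npoint (pos x) (pos y) = npoint (pos (- x)) (pos (- y)).
  apply: compO; rewrite /pos; try by apply: boxO; lia.
  by rewrite -[M _]/(congruent M _ _) congruent_npoint; apply: zvec_congr xyM _ _; lia.
by rewrite /pos; lia.
Qed.

Variables (p q : nat).
Hypotheses (p_gt0 : (0 < p)%N) (q_gt0 : (0 < q)%N).
Hypotheses (Mp : M (zvec p%:Z 0)) (Mq : M (zvec 0 q%:Z)).

Lemma congruent_shift_x u v : congruent M (npoint (u + p) v) (npoint u v).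
Proof. by rewrite congruent_npoint; apply: zvec_congr Mp _ _; lia. Qed.

Lemma congruent_shift_y u v : congruent M (npoint u (v + q)) (npoint u v).
Proof. by rewrite congruent_npoint; apply: zvec_congr Mq _ _; lia. Qed.

Lemma least_element (T : eqType) (le : rel T) (P : T -> Prop) (s : seq T) :
  total le -> transitive le -> (exists2 x, x \in s & P x) ->
  exists2 x, P x & forall y, y \in s -> P y -> le x y.
Proof.
move=> tot tr; elim: s => [[]//|a s IHs] exP.
case: (classic (exists2 x, x \in s & P x)) => [/IHs[x Px xP]|no]; last first.
  have nos y : y \in s -> ~ P y by move=> ys Py; apply: no; exists y.
  move: exP => [x]; rewrite inE => /predU1P[->|/nos//] Pa; exists a => // y.
  by rewrite inE => /predU1P[-> _|/nos//]; have := tot a a; rewrite orbb.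
have [[Pa ax]|nax] := classic (P a /\ le a x).
  exists a => // y; rewrite inE => /predU1P[-> _|ys Py].
    by have := tot a a; rewrite orbb.
  by apply: tr ax _; exact: xP.
exists x => // y; rewrite inE => /predU1P[-> Pa|]; last exact: xP.
have := tot a x; case: (boolP (le a x)) => [ax|//].
by case: nax.
Qed.

(** A term order extends the componentwise order, so reducing the coordinates
    modulo [p] and [q] never increases a point: it is enough to minimise over
    the finitely many points of a box. *)
Lemma standard_exists le m : term_order le ->
  exists2 r, standard M le r & congruent M m r.
Proof.
move=> leT; case: (leT) => tot _ tr _ _.
have box u v : congruent M (npoint u v) (npoint (u %% p) (v %% q)).
  have up i a b : congruent M (npoint (a + i * p) b) (npoint a b).
    elim: i => [|i IHi]; first by rewrite addn0; exact: congruent_refl.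
    rewrite mulSn [(p + _)%N]addnC addnA.
    exact: (congruent_trans M0 MB (congruent_shift_x _ _) IHi).
  have vq j a b : congruent M (npoint a (b + j * q)) (npoint a b).
    elim: j => [|j IHj]; first by rewrite addn0; exact: congruent_refl.
    rewrite mulSn [(q + _)%N]addnC addnA.
    exact: (congruent_trans M0 MB (congruent_shift_y _ _) IHj).
  rewrite {1}(divn_eq u p) {1}(divn_eq v q) ![(_ * _ + _)%N]addnC.
  exact: (congruent_trans M0 MB (up _ _ _) (vq _ _ _)).
pose s := [seq npoint u v | u <- iota 0 p, v <- iota 0 q].
have sP u v : npoint (u %% p) (v %% q) \in s.
  by apply: allpairs_f; rewrite mem_iota /= add0n ltn_mod.
have [|r mr rP] := @least_element _ le (congruent M m) s tot tr.
  exists (npoint (m ord0 %% p) (m ord_max %% q)); first exact: sP.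
  by rewrite {1}(npoint_coord m).
exists r => // l rl; rewrite (npoint_coord l).
set u := l ord0; set v := l ord_max.
have lr : congruent M (npoint u v) (npoint (u %% p) (v %% q)) by exact: box.
have rl' : le r (npoint (u %% p) (v %% q)).
  apply: rP (sP _ _) _; apply: (congruent_trans M0 MB mr).
  by apply: (congruent_trans M0 MB rl); rewrite {1}(npoint_coord l).
apply: tr rl' _; apply: term_order_lepm => //.
by rewrite npoint_le !leq_mod.
Qed.

Definition weight_order (w1 w2 : nat) : rel 'X_{1..2} := fun m l =>
  let w m := (w1 * m ord0 + w2 * m ord_max)%N in
  (w m < w l)%N || (w m == w l) && (m ord0 <= l ord0)%N.

Lemma weight_term_order w1 w2 :
  (0 < w1)%N -> (0 < w2)%N -> term_order (weight_order w1 w2).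
Proof.
move=> w1_gt0 w2_gt0; rewrite /weight_order; split.
- by move=> m l; lia.
- move=> m l /andP[ml lm].
  have m0 : m ord0 = l ord0 by lia.
  rewrite (npoint_coord m) (npoint_coord l) m0; congr npoint.
  move: ml lm; rewrite m0; nia.
- by move=> m l k; lia.
- by move=> m; rewrite !mnm0E; lia.
- by move=> m l k; rewrite !mnmDE !mulnDr; lia.
Qed.

(** The weight is chosen to give (a, 0) more weight than (0, a') and (0, b) more
    weight than (b', 0); both inequalities amount to a' b' < a b. Then any point
    outside [O] can be replaced by a lighter congruent point. *)
Lemma weight_standard O a a' b b' :
  order_ideal O -> compatible M O -> (a' < b)%N -> (b' < a)%N ->
  congruent M (npoint a 0) (npoint 0 a') ->
  congruent M (npoint 0 b) (npoint b' 0) ->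
  (forall m, ~ O m -> [\/ (npoint a 0 <= m)%MM, (npoint 0 b <= m)%MM
     | exists c, [/\ (c <= m)%MM, c != 0%MM & congruent M c 0%MM]]) ->
  forall m, standard M (weight_order (b + a') (a + b')) m <-> O m.
Proof.
move=> ordO compO a'b b'a aa' bb' nO.
set le := weight_order _ _.
have leT : term_order le by apply: weight_term_order; lia.
have stO m : standard M le m -> O m.
  move=> stm; apply: NNPP => nm.
  have descent c r : (c <= m)%MM -> congruent M c r -> ~~ le c r -> False.
    move=> cm cr /negP; apply.
    apply: (standard_order_ideal leT cm stm) cr.
  case: (nO m nm) => [am|bm|[c [cm c0 cM]]].
  - apply: descent am aa' _; rewrite /le /weight_order !npointE; nia.
  - apply: descent bm bb' _; rewrite /le /weight_order !npointE; nia.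
  - apply: descent cm cM _; rewrite /le /weight_order !mnm0E.
    have : (c ord0 != 0%N) || (c ord_max != 0%N).
      rewrite -negb_and; apply: contra c0 => /andP[/eqP c0 /eqP c1].
      by rewrite (npoint_coord c) c0 c1 npoint0.
    nia.
move=> m; split=> [/stO//|Om].
have [r str mr] := standard_exists m leT.
by rewrite (compO m r Om (stO r str) mr).
Qed.


(** * The corners of a plane order ideal *)

(** Everything follows from the disjointness of the supports of a corner and its
    representative: on the axes it puts the representative on the other axis,
    off the axes it forces the representative to be 0. *)
Lemma saturated_corners O :
  order_ideal O -> compatible M O ->
  (forall c, corner O c -> exists2 r, O r & congruent M c r) ->
  exists a a' b b' : nat,
    [/\ [/\ (a' < b)%N & (b' < a)%N], O (npoint 0 a'), O (npoint b' 0),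
        congruent M (npoint a 0) (npoint 0 a')
      & congruent M (npoint 0 b) (npoint b' 0)] /\
    (two_corners O a a' b b' \/ three_corners O a b).
Proof.
move=> ordO compO satO.
have O0 : O (npoint 0 0).
  rewrite npoint0; have Oge0 m : O m -> O 0%MM.
    by apply: ordO; apply/mnm_lepP => i; rewrite mnm0E.
  apply: NNPP => nO0; have [c cc _] := corner_below nO0.
  by have [r /Oge0] := satO c cc.
have disj c1 c2 r1 r2 : corner O (npoint c1 c2) -> O (npoint r1 r2) ->
    congruent M (npoint c1 c2) (npoint r1 r2) ->
    (c1 = 0%N \/ r1 = 0%N) /\ (c2 = 0%N \/ r2 = 0%N).
  move=> cc Or cr; split.
    by have := corner_representative_disjoint ord0 ordO compO cc Or cr; rewrite !npointE.
  by have := corner_representative_disjoint ord_max ordO compO cc Or cr; rewrite !npointE.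
have below c1 c2 u v : corner O (npoint c1 c2) -> (u <= c1)%N -> (v <= c2)%N ->
    (u != c1) || (v != c2) -> O (npoint u v).
  move=> cc uc vc ne; apply: corner_pred cc _ _; first by rewrite npoint_le uc.
  by rewrite npoint_eq negb_and.
have compE u v u' v' : O (npoint u v) -> O (npoint u' v') ->
    M (zvec (u%:Z - u'%:Z) (v%:Z - v'%:Z)) -> u = u' /\ v = v'.
  by move=> Ou Ou'; rewrite -congruent_npoint => /(compO _ _ Ou Ou')/npoint_inj.
have [a ca] : exists a, corner O (npoint a 0).
  have nOp : ~ O (npoint p 0).
    move=> Op; have [] := compE _ _ _ _ Op O0; last by lia.
    by apply: zvec_congr Mp _ _; lia.
  have [c cc] := corner_below nOp.
  rewrite (npoint_coord c) npoint_le leqn0 => /andP[_ /eqP c1].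
  by exists (c ord0); rewrite (npoint_coord c) c1 in cc.
have [b cb] : exists b, corner O (npoint 0 b).
  have nOq : ~ O (npoint 0 q).
    move=> Oq; have [] := compE _ _ _ _ Oq O0; last by lia.
    by apply: zvec_congr Mq _ _; lia.
  have [c cc] := corner_below nOq.
  rewrite (npoint_coord c) npoint_le leqn0 => /andP[/eqP c0 _].
  by exists (c ord_max); rewrite (npoint_coord c) c0 in cc.
have a_gt0 : (0 < a)%N by rewrite lt0n; apply/eqP => a0; rewrite a0 in ca; case: ca.
have b_gt0 : (0 < b)%N by rewrite lt0n; apply/eqP => b0; rewrite b0 in cb; case: cb.
have [a' Oa' aa'] : exists2 a', O (npoint 0 a') & congruent M (npoint a 0) (npoint 0 a').
  have [r] := satO _ ca; rewrite (npoint_coord r) => Or ar.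
  have [[a0|r0] _] := disj _ _ _ _ ca Or ar; first by lia.
  by exists (r ord_max); rewrite r0 in Or ar.
have [b' Ob' bb'] : exists2 b', O (npoint b' 0) & congruent M (npoint 0 b) (npoint b' 0).
  have [r] := satO _ cb; rewrite (npoint_coord r) => Or br.
  have [_ [b0|r1]] := disj _ _ _ _ cb Or br; first by lia.
  by exists (r ord0); rewrite r1 in Or br.
have a'b : (a' < b)%N.
  rewrite ltnNge; apply/negP => ba'; apply: cb.1; apply: ordO Oa'.
  by rewrite npoint_le.
have b'a : (b' < a)%N.
  rewrite ltnNge; apply/negP => ab'; apply: ca.1; apply: ordO Ob'.
  by rewrite npoint_le ab'.
exists a, a', b, b'; split; first by split.
have cornerP c1 c2 : corner O (npoint c1 c2) ->
    npoint c1 c2 = npoint a 0 \/ npoint c1 c2 = npoint 0 b \/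
    [/\ 0 < c1 < a, 0 < c2 < b & M (zvec c1%:Z c2%:Z)]%N.
  move=> cc.
  have [c1a|c1a] := leqP a c1.
    by left; apply/esym/(corner_antichain ca cc); rewrite npoint_le c1a.
  have [c2b|c2b] := leqP b c2.
    by right; left; apply/esym/(corner_antichain cb cc); rewrite npoint_le c2b.
  have [c10|c1_gt0] := posnP c1.
    right; left; apply: (corner_antichain cc cb); rewrite c10 npoint_le; lia.
  have [c20|c2_gt0] := posnP c2.
    left; apply: (corner_antichain cc ca); rewrite c20 npoint_le; lia.
  right; right; split=> //.
  have [r] := satO _ cc; rewrite (npoint_coord r) => Or cr.
  have [r0 r1] := disj _ _ _ _ cc Or cr.
  move: cr; rewrite congruent_npoint => cr; apply: zvec_congr cr _ _; lia.
have aa'M := aa'; rewrite congruent_npoint in aa'M.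
have bb'M := bb'; rewrite congruent_npoint in bb'M.
have [[c1 [c2 [cc [/andP[c1_gt0 c1a] /andP[c2_gt0 c2b] cM]]]]|no] :=
  classic (exists c1 c2, corner O (npoint c1 c2) /\
    [/\ 0 < c1 < a, 0 < c2 < b & M (zvec c1%:Z c2%:Z)]%N).
- right; exists c1, c2; split=> //.
    by rewrite congruent_npoint; apply: zvec_congr cM _ _; lia.
  (* for two corners off the axes, say with d1 < e1 and then e2 < d2, the points
     (e1 - d1, 0) and (0, d2 - e2) of [O] are congruent *)
  have uniq_c d1 d2 e1 e2 : corner O (npoint d1 d2) -> corner O (npoint e1 e2) ->
      M (zvec d1%:Z d2%:Z) -> M (zvec e1%:Z e2%:Z) -> (0 < d1)%N -> (0 < e2)%N ->
      (d1 < e1)%N -> False.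
    move=> cd ce dM eM d1_gt0 e2_gt0 de.
    have ed : (e2 < d2)%N.
      rewrite ltnNge; apply/negP => d2e2.
      have /npoint_inj[] : npoint d1 d2 = npoint e1 e2.
        by apply: (corner_antichain cd ce); rewrite npoint_le d2e2 ltnW.
      lia.
    have O1 : O (npoint (e1 - d1) 0) by apply: below ce _ _ _; lia.
    have O2 : O (npoint 0 (d2 - e2)) by apply: below cd _ _ _; lia.
    have [] := compE _ _ _ _ O1 O2; last by lia.
    by have := MB eM dM; rewrite zvecB => M12; apply: zvec_congr M12 _ _; lia.
  move=> m; rewrite (npoint_coord m) !inE; set u := m ord0; set v := m ord_max.
  split=> [cm|/or3P[]/eqP -> //].
  have [->|[->|[/andP[u_gt0 ua] /andP[v_gt0 vb] uvM]]] := cornerP _ _ cm;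
    rewrite ?eqxx ?orbT //.
  suff -> : npoint u v = npoint c1 c2 by rewrite eqxx !orbT.
  have [uc|cu|uc] := ltngtP u c1.
  + by case: (uniq_c u v c1 c2).
  + by case: (uniq_c c1 c2 u v).
  + have [vc|cv] := leqP v c2; last apply/esym.
      by apply: (corner_antichain cm cc); rewrite npoint_le uc leqnn vc.
    by apply: (corner_antichain cc cm); rewrite npoint_le uc leqnn ltnW.
- left; split=> [m|].
    rewrite (npoint_coord m) !inE; set u := m ord0; set v := m ord_max.
    split=> [cm|/orP[]/eqP -> //].
    have [->|[->|uvM]] := cornerP _ _ cm; rewrite ?eqxx ?orbT //.
    by case: no; exists u, v; split.
  apply: NNPP => /not_or_and[/eqP a'0 /eqP b'0].
  (* this point is (A - A') + (B - B'), hence congruent to 0 *)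
  have [|] := classic (O (npoint (a - b') (b - a'))).
    move=> /compE /(_ O0)[]; last by lia.
    have := latticeD M0 MB aa'M bb'M; rewrite zvecD => abM.
    by apply: zvec_congr abM _ _; lia.
  move=> /corner_below[c]; rewrite (npoint_coord c) npoint_le => cc /andP[ca' cb'].
  case: (cornerP _ _ cc) => [/npoint_inj[c0 _]|[/npoint_inj[_ c1]|cP]].
  + by lia.
  + by lia.
  + by case: no; exists (c ord0), (c ord_max); split.
Qed.

Lemma maximal_compatible_standard O : maximal_compatible M O ->
  exists2 le, term_order le & forall m, standard M le m <-> O m.
Proof.
move=> maxO; have [ordO compO _] := maxO.
have [a [a' [b [b' [[[a'b b'a] _ _ aa' bb'] cO]]]]] :=
  saturated_corners ordO compO
    (fun c => @maximal_compatible_saturated _ _ M0 MB O c maxO).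
exists (weight_order (b + a') (a + b')); first by apply: weight_term_order; lia.
apply: weight_standard => // m /corner_below[c cc cm].
case: cO => [[cornE _]|[c1 [c2 [c1_gt0 _ cM cornE]]]].
  by have := (cornE c).1 cc; rewrite !inE => /orP[]/eqP <-; [constructor 1|constructor 2].
have := (cornE c).1 cc; rewrite !inE => /or3P[]/eqP cE.
- by constructor 1; rewrite -cE.
- by constructor 2; rewrite -cE.
constructor 3; exists c; split=> //; last by rewrite -npoint0 cE.
by rewrite cE -npoint0 npoint_eq; lia.
Qed.

(** * Reduced Groebner bases in the plane *)

Section Reduced.

Variables (K : fieldType) (le : rel 'X_{1..2}).
Hypothesis leT : term_order le.
Local Notation I := (lattice_ideal (K := K) M).
Local Notation std := (standard M le).
Variables (a a' b b' : nat).
Hypotheses (sa' : std (npoint 0 a')) (sb' : std (npoint b' 0)).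
Hypothesis aa' : congruent M (npoint a 0) (npoint 0 a').
Hypothesis bb' : congruent M (npoint 0 b) (npoint b' 0).
Implicit Types G : {fset {mpoly K[2]}}.

Lemma two_corners_reduced G :
  (forall m, corner std m <-> m \in [:: npoint a 0; npoint 0 b]) ->
  reduced_groebner_basis le G I <->
  G = [fset monomial K a 0 - monomial K 0 a';
            monomial K 0 b - monomial K b' 0]%fset.
Proof.
move=> cornE.
rewrite (@reduced_groebner_basis_corners _ K _ _
  [:: (npoint a 0, npoint 0 a'); (npoint 0 b, npoint b' 0)] G M0 MB leT) //.
- have mapE g : (g \in [seq 'X_[K, x.1] - 'X_[x.2] |
      x <- [:: (npoint a 0, npoint 0 a'); (npoint 0 b, npoint b' 0)]]) =
    (g \in [fset monomial K a 0 - monomial K 0 a';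
                 monomial K 0 b - monomial K b' 0]%fset).
    exact: mem_seq_fset2.
  split=> [GE|-> g]; last by rewrite mapE.
  by apply/fsetP => g; rewrite GE mapE.
- by move=> m; exact: standard_exists.
- by move=> x; rewrite !inE => /orP[]/eqP ->.
Qed.

Lemma three_corners_reduced c1 c2 G :
  congruent M (npoint c1 c2) (npoint 0 0) ->
  (forall m, corner std m <-> m \in [:: npoint a 0; npoint 0 b; npoint c1 c2]) ->
  reduced_groebner_basis le G I <->
  G = [fset monomial K a 0 - monomial K 0 a';
            monomial K 0 b - monomial K b' 0;
            monomial K c1 c2 - 1]%fset.
Proof.
move=> cM cornE.
have s0 : std (npoint 0 0) by rewrite npoint0 => l _; case: leT.
rewrite -(monomial00 K) (@reduced_groebner_basis_corners _ K _ _
  [:: (npoint a 0, npoint 0 a'); (npoint 0 b, npoint b' 0);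
      (npoint c1 c2, npoint 0 0)] G M0 MB leT) //.
- have mapE g : (g \in [seq 'X_[K, x.1] - 'X_[x.2] |
      x <- [:: (npoint a 0, npoint 0 a'); (npoint 0 b, npoint b' 0);
               (npoint c1 c2, npoint 0 0)]]) =
    (g \in [fset monomial K a 0 - monomial K 0 a';
                 monomial K 0 b - monomial K b' 0;
                 monomial K c1 c2 - monomial K 0 0]%fset).
    exact: mem_seq_fset3.
  split=> [GE|-> g]; last by rewrite mapE.
  by apply/fsetP => g; rewrite GE mapE.
- by move=> m; exact: standard_exists.
- by move=> x; rewrite !inE => /or3P[]/eqP ->.
Qed.

End Reduced.

Lemma reduced_groebner_basis_exists (K : fieldType) le : term_order le ->
  exists G, reduced_groebner_basis le G (lattice_ideal (K := K) M).
Proof.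
move=> leT.
have [a [a' [b [b' [[_ sa' sb' aa' bb'] cO]]]]] := saturated_corners
  (standard_order_ideal leT) (standard_compatible M0 MB leT)
  (fun c _ => @standard_exists _ c leT).
case: cO => [[cornE _]|[c1 [c2 [_ _ cM cornE]]]].
  by eexists; apply: (proj2 (two_corners_reduced leT sa' sb' aa' bb' _ cornE)).
by eexists; apply: (proj2 (three_corners_reduced leT sa' sb' aa' bb' _ cM cornE)).
Qed.

(** The box [0, a) x [0, b) is the set of standard points of a weight order. *)
Lemma box_reduced (K : fieldType) (a a' b b' : nat) :
  (a' < b)%N -> (b' < a)%N ->
  M (zvec a%:Z (- a'%:Z)) -> M (zvec (- b'%:Z) b%:Z) ->
  (forall x y : int, `|x| < a%:Z -> `|y| < b%:Z -> M (zvec x y) -> x = 0 /\ y = 0) ->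
  is_reduced_groebner_basis
    [fset monomial K a 0 - monomial K 0 a';
          monomial K 0 b - monomial K b' 0]%fset
    (lattice_ideal (K := K) M).
Proof.
move=> a'b b'a aM bM box0.
have aa' : congruent M (npoint a 0) (npoint 0 a').
  by rewrite congruent_npoint; apply: zvec_congr aM _ _; lia.
have bb' : congruent M (npoint 0 b) (npoint b' 0).
  by rewrite congruent_npoint; apply: zvec_congr bM _ _; lia.
pose O (m : 'X_{1..2}) := (m ord0 < a)%N && (m ord_max < b)%N.
have ordO : order_ideal O.
  move=> l m; rewrite (npoint_coord l) (npoint_coord m) npoint_le /O !npointE.
  lia.
have compO : compatible M O.
  move=> l m; rewrite (npoint_coord l) (npoint_coord m) /O !npointE.
  move=> Ol Om; rewrite -[M _]/(congruent M _ _) congruent_npoint.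
  by move=> /box0[||x0 y0]; [lia | lia | congr npoint; lia].
have stO := weight_standard ordO compO a'b b'a aa' bb'.
have {}stO m : standard M (weight_order (b + a') (a + b')) m <-> O m.
  apply: stO => l nl; have [al|bl] : (a <= l ord0 \/ b <= l ord_max)%N.
    by move: nl; rewrite /O; lia.
  - by constructor 1; rewrite (npoint_coord l) npoint_le al.
  - by constructor 2; rewrite (npoint_coord l) npoint_le bl.
have leT : term_order (weight_order (b + a') (a + b')).
  by apply: weight_term_order; lia.
exists (weight_order (b + a') (a + b')); split=> //.
have sa' : standard M (weight_order (b + a') (a + b')) (npoint 0 a').
  by apply/stO; rewrite /O !npointE; lia.
have sb' : standard M (weight_order (b + a') (a + b')) (npoint b' 0).
  by apply/stO; rewrite /O !npointE; lia.
apply: (proj2 (two_corners_reduced leT sa' sb' aa' bb' _ _)) => //.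
move=> m; rewrite (corner_ext m stO) (npoint_coord m) !inE !npoint_eq.
set u := m ord0; set v := m ord_max.
split=> [[nO minO]|uv].
  have nO' : (a <= u \/ b <= v)%N by move: nO; rewrite /O !npointE; lia.
  case: nO' => uv.
    have /npoint_inj[] : npoint a 0 = npoint u v.
      by apply: minO; rewrite ?npoint_le ?uv // /O !npointE ltnn.
    lia.
  have /npoint_inj[] : npoint 0 b = npoint u v.
    by apply: minO; rewrite ?npoint_le ?uv // /O !npointE ltnn andbF.
  lia.
split=> [|l]; first by rewrite /O !npointE; lia.
rewrite (npoint_coord l) npoint_le /O !npointE => nO lu; congr npoint; lia.
Qed.

End Plane.

Lemma card_two_corners (K : fieldType) (a a' b b' : nat) :
  (a' < b)%N -> (b' < a)%N ->
  #|` [fset monomial K a 0 - monomial K 0 a';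
            monomial K 0 b - monomial K b' 0]|%fset = 2%N.
Proof.
move=> a'b b'a; rewrite cardfs2; case: eqP => // /(@corner_binomial_inj 2 K
  (fun m => m \in [:: npoint 0 a'; npoint b' 0])).
rewrite !inE !npoint_eq => /(_ _ _ _ _)/npoint_inj[] //; lia.
Qed.

Lemma card_three_corners (K : fieldType) (a a' b b' c1 c2 : nat) :
  (a' < b)%N -> (b' < a)%N -> (0 < c1)%N -> (0 < c2)%N ->
  #|` [fset monomial K a 0 - monomial K 0 a';
            monomial K 0 b - monomial K b' 0;
            monomial K c1 c2 - 1]|%fset = 3%N.
Proof.
move=> a'b b'a c1_gt0 c2_gt0; rewrite fsetUC cardfsU1 card_two_corners //.
rewrite -(monomial00 K) in_fset2.
have inj := @corner_binomial_inj 2 K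
  (fun m => m \in [:: npoint 0 a'; npoint b' 0; npoint 0 0]).
by case: eqP => [/inj|_]; [|case: eqP => [/inj|//]];
  rewrite !inE !npoint_eq => /(_ _ _ _ _)/npoint_inj[] //; lia.
Qed.

(** A box [0, a) x [0, b) larger than [p] x [q] would contain (p, 0) and
    (0, e), or 0 and (0, q), which are congruent; divisibility excludes smaller
    boxes. It is stated for a relation so that it also applies after exchanging
    the coordinates. *)
Lemma box_sides_unique (L : int -> int -> Prop) (p e q a a' b : nat) :
  (forall u v u' v', L u v -> L u' v' -> L (u - u') (v - v')) ->
  (forall u v, L u v -> (p%:Z %| u)%Z) -> (forall v, L 0 v -> (q%:Z %| v)%Z) ->
  (0 < p)%N -> (e < q)%N -> L p%:Z (- e%:Z) -> L 0 q%:Z ->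
  (0 < a)%N -> (a' < b)%N -> L a%:Z (- a'%:Z) -> L 0 b%:Z ->
  (forall x y : int, `|x| < a%:Z -> `|y| < b%:Z -> L x y -> x = 0 /\ y = 0) ->
  [/\ a = p, b = q & a' = e].
Proof.
move=> LB Lp Lq p_gt0 eq Lpe L0q a_gt0 a'b Laa' L0b box0.
have b_gt0 : (0 < b)%N by lia.
have pa : (p <= a)%N by apply: dvdn_leq => //; have := Lp _ _ Laa'.
have qb : (q <= b)%N by apply: dvdn_leq => //; have := Lq _ L0b.
have bq : b = q.
  apply/eqP; rewrite eqn_leq qb andbT leqNgt; apply/negP => ltqb.
  by have [] := box0 0 q%:Z _ _ L0q; lia.
have ap : a = p.
  apply/eqP; rewrite eqn_leq pa andbT leqNgt; apply/negP => ltpa.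
  by have [] := box0 p%:Z (- e%:Z) _ _ Lpe; lia.
split=> //; have := LB _ _ _ _ Lpe Laa'; rewrite ap subrr => Lea.
by have [] := box0 0 (- e%:Z - - a'%:Z) _ _ Lea; lia.
Qed.

Lemma inIntSpan2 (V : zmodType) (x y v : V) :
  inIntSpan [tuple x; y] v <-> exists k l : int, v = x *~ k + y *~ l.
Proof.
split=> [[f ->]|[k [l ->]]].
  by exists (f ord0), (f (lift ord0 ord0)); rewrite !big_ord_recl big_ord0 addr0.
exists [ffun i : 'I_2 => if val i == 0%N then k else l].
by rewrite !big_ord_recl big_ord0 addr0 !ffunE.
Qed.

Lemma zvecMz u v k : zvec u v *~ k = zvec (u * k) (v * k).
Proof.
by apply/rowP => -[[|[|//]] lti]; rewrite -scaler_int !mxE intz mulrC.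
Qed.

Lemma inIntSpan_zvec (u1 v1 u2 v2 u v : int) :
  inIntSpan [tuple zvec u1 v1; zvec u2 v2] (zvec u v) <->
  exists k l : int, u = u1 * k + u2 * l /\ v = v1 * k + v2 * l.
Proof.
rewrite inIntSpan2; split=> -[k [l E]]; exists k, l.
  by move: E; rewrite !zvecMz zvecD => /zvec_inj.
by rewrite !zvecMz zvecD E.1 E.2.
Qed.

(** * The two triangular bases of a plane lattice *)

Lemma small_multiple (a : nat) (k : int) : `|a%:Z * k| < a%:Z -> k = 0.
Proof.
apply: contraTeq => k0; rewrite -leNgt normrM ger0_norm // ler_peMr //.
by lia.
Qed.

Section TriangularBases.

Variables (M : 'rV[int]_2 -> Prop) (a1 a2 a3 b1 b2 b3 : nat).
Hypothesis MB : forall u v, M u -> M v -> M (u - v).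
Hypothesis Ma : forall u v, M (zvec u v) <->
  exists k l : int, u = a1%:Z * k /\ v = a2%:Z * k + a3%:Z * l.
Hypothesis Mb : forall u v, M (zvec u v) <->
  exists k l : int, u = b1%:Z * k + b3%:Z * l /\ v = b2%:Z * k.
Hypotheses (a1_gt0 : (0 < a1)%N) (b2_gt0 : (0 < b2)%N).

Lemma a_box_trivial x y : `|x| < a1%:Z -> `|y| < a3%:Z -> M (zvec x y) -> x = 0 /\ y = 0.
Proof.
move=> xa ya /Ma[k [l [xE yE]]].
have k0 : k = 0 by apply: (@small_multiple a1); rewrite -xE.
rewrite k0 !mulr0 ?add0r in xE yE.
by have l0 : l = 0; [apply: (@small_multiple a3); rewrite -yE | rewrite yE l0 mulr0].
Qed.

Lemma b_box_trivial x y : `|x| < b3%:Z -> `|y| < b2%:Z -> M (zvec x y) -> x = 0 /\ y = 0.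
Proof.
move=> xb yb /Mb[k [l [xE yE]]].
have k0 : k = 0 by apply: (@small_multiple b2); rewrite -yE.
rewrite k0 !mulr0 ?add0r in xE yE.
by have l0 : l = 0; [apply: (@small_multiple b3); rewrite -xE | rewrite xE l0 mulr0].
Qed.

Variables (e f : nat).
Hypotheses (e_lt : (e < a3)%N) (f_lt : (f < b3)%N).
Hypotheses (eM : M (zvec a1%:Z (- e%:Z))) (fM : M (zvec (- f%:Z) b2%:Z)).

(** If b' = 0, then (0, b) lies in the lattice, and the basis with (0, a3) determines
    the box; if a' = 0, the basis with (b3, 0) does. *)
Lemma two_corners_unique O a a' b b' :
  compatible M O -> (a' < b)%N -> (b' < a)%N ->
  congruent M (npoint a 0) (npoint 0 a') ->
  congruent M (npoint 0 b) (npoint b' 0) ->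
  two_corners O a a' b b' ->
  [/\ a = a1, a' = e, b = a3 & b' = 0%N] \/ [/\ a = b3, a' = 0%N, b = b2 & b' = f].
Proof.
move=> compO a'b b'a; rewrite !congruent_npoint => aa' bb' cO.
have box0 := two_corners_box compO cO.
have Mq : M (zvec 0 a3%:Z) by apply/Ma; exists 0, 1; split; ring.
have Mp : M (zvec b3%:Z 0) by apply/Mb; exists 0, 1; split; ring.
case: cO => _ [a'0|b'0]; [right|left].
  have Ldvd u v : M (zvec v u) -> (b2%:Z %| u)%Z.
    by move=> /Mb[k [l [_ ->]]]; apply: dvdz_mulr.
  have Ldvd0 v : M (zvec v 0) -> (b3%:Z %| v)%Z.
    move=> /Mb[k [l [-> /esym/eqP]]]; rewrite mulf_eq0 => /orP[|/eqP ->]; first by lia.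
    by rewrite mulr0 add0r; apply: dvdz_mulr.
  have [||||||-> -> ->] := @box_sides_unique (fun u v => M (zvec v u)) b2 f b3 b b' a
    _ Ldvd Ldvd0 b2_gt0 f_lt fM Mp; last by rewrite a'0.
  - by move=> u v u' v' Mu Mu'; rewrite -zvecB; apply: MB.
  - lia.
  - exact: b'a.
  - by apply: zvec_congr bb' _ _; lia.
  - by apply: zvec_congr aa' _ _; lia.
  - by move=> x y xb ya /(box0 _ _ ya xb)[].
have Ldvd u v : M (zvec u v) -> (a1%:Z %| u)%Z.
  by move=> /Ma[k [l [-> _]]]; apply: dvdz_mulr.
have Ldvd0 v : M (zvec 0 v) -> (a3%:Z %| v)%Z.
  move=> /Ma[k [l [/esym/eqP]]]; rewrite mulf_eq0 => /orP[|/eqP ->]; first by lia.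
  by rewrite mulr0 add0r => ->; apply: dvdz_mulr.
have [||||||-> -> ->] := @box_sides_unique (fun u v => M (zvec u v)) a1 e a3 a a' b
  _ Ldvd Ldvd0 a1_gt0 e_lt eM Mq; last by rewrite b'0.
- by move=> u v u' v' Mu Mu'; rewrite -zvecB; apply: MB.
- lia.
- exact: a'b.
- by apply: zvec_congr aa' _ _; lia.
- by apply: zvec_congr bb' _ _; lia.
- exact: box0.
Qed.

End TriangularBases.

Theorem proposition23 (K : fieldType) (M : 'rV[int]_2 -> Prop)
    (a1 a2 a3 b1 b2 b3 lam : nat)
    (ha1 : (0 < a1)%N) (ha23 : (a2 < a3)%N)
    (hM : forall v, M v <-> inIntSpan [tuple zvec a1%:Z a2%:Z; zvec 0 a3%:Z] v)
    (hb2 : b2 = gcdn a2 a3)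
    (hb3 : b3 = ((a1 * a3) %/ b2)%N)
    (hlam : is_least (fun k : nat =>
              exists mu : int, b2%:Z = k%:Z * a2%:Z + mu * a3%:Z) lam)
    (hb1 : b1 = (a1 * lam)%N) :
  let I : {mpoly K[2]} -> Prop := lattice_ideal (K := K) M in
  let G1 : {fset {mpoly K[2]}} :=
    [fset monomial K a1 0 - monomial K 0 ((a3 - a2) %% a3)%N;
          monomial K 0 a3 - 1]%fset in
  let G2 : {fset {mpoly K[2]}} :=
    [fset monomial K b3 0 - 1;
          monomial K 0 b2 - monomial K ((b3 - b1) %% b3)%N 0]%fset in
  [/\ [/\ (0 < b2)%N, (b1 < b3)%N
        & forall v, M v <-> inIntSpan [tuple zvec b1%:Z b2%:Z; zvec b3%:Z 0] v],
      (forall O : 'X_{1..2} -> Prop,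
         maximal_compatible M O <->
         exists (le : rel 'X_{1..2}) (G : {fset {mpoly K[2]}}),
           [/\ term_order le, groebner_basis le G I
             & forall m, O m <-> irreducible_monomial le G m]),
      (forall G : {fset {mpoly K[2]}},
         is_reduced_groebner_basis G I /\ #|` G|%fset = 2%N <->
         G = G1 \/ G = G2),
      (G1 = G2 <-> a2 = 0%N)
    & (forall (le : rel 'X_{1..2}) (G : {fset {mpoly K[2]}}),
         term_order le -> reduced_groebner_basis le G I ->
         G <> G1 -> G <> G2 ->
         #|` G|%fset = 3%N /\
         exists alpha alpha' beta beta' gamma1 gamma2 : nat,
           let O : 'X_{1..2} -> Prop := irreducible_monomial le G in
           let A := npoint alpha 0 in let A' := npoint 0 alpha' in
           let B := npoint 0 beta in let B' := npoint beta' 0 in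
           let C := npoint gamma1 gamma2 in
           [/\ G = [fset monomial K alpha 0 - monomial K 0 alpha';
                         monomial K 0 beta - monomial K beta' 0;
                         monomial K gamma1 gamma2 - 1]%fset,
               maximal_compatible M O,
               uniq [:: A; B; C] /\
                 (forall m, corner O m <-> m \in [:: A; B; C]),
               representative M O A A'
             & representative M O B B'])].
Proof.
move=> I G1 G2.
have M0 : M 0.
  by apply/hM/inIntSpan2; exists 0, 0; rewrite !mulr0z addr0.
have MB u v : M u -> M v -> M (u - v).
  move=> /hM/inIntSpan2[k [l ->]] /hM/inIntSpan2[k' [l' ->]].
  apply/hM/inIntSpan2; exists (k - k'), (l - l').
  by rewrite !mulrzBr opprD addrACA.
have Ma u v : M (zvec u v) <->
    exists k l : int, u = a1%:Z * k /\ v = a2%:Z * k + a3%:Z * l.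
  rewrite hM inIntSpan_zvec.
  by split=> -[k [l [-> ->]]]; exists k, l; rewrite mul0r addr0.
have b2_gt0 : (0 < b2)%N by rewrite hb2 gcdn_gt0; lia.
have [a2' a2E] : exists a2', a2 = (a2' * b2)%N.
  by apply/dvdnP; rewrite hb2 dvdn_gcdl.
have [a3' a3E] : exists a3', a3 = (a3' * b2)%N.
  by apply/dvdnP; rewrite hb2 dvdn_gcdr.
have a3'_gt0 : (0 < a3')%N by rewrite lt0n; apply/eqP => E; rewrite E in a3E; lia.
have b3E : b3 = (a1 * a3')%N by rewrite hb3 a3E mulnA mulnK.
have [[mu muE] lam_min] := hlam.
have bezout : 1 = lam%:Z * a2'%:Z + mu * a3'%:Z.
  apply: (@mulIf _ b2%:Z); first by lia.
  by rewrite mul1r {1}muE a2E a3E !PoszM; ring.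
(* the condition on [lam] only depends on its residue modulo [a3'] *)
have lam_lt : (lam < a3')%N.
  have : (lam <= lam %% a3')%N.
    apply: lam_min; exists (mu + (lam %/ a3')%:Z * a2'%:Z).
    rewrite muE {1}(divn_eq lam a3') a2E a3E !PoszD !PoszM; ring.
  by move=> /leq_ltn_trans; apply; rewrite ltn_mod.
have b13 : (b1 < b3)%N by rewrite hb1 b3E ltn_pmul2l.
have Mb u v : M (zvec u v) <->
    exists k l : int, u = b1%:Z * k + b3%:Z * l /\ v = b2%:Z * k.
  rewrite Ma; split=> -[k [l [-> ->]]].
    exists (a2'%:Z * k + a3'%:Z * l), (mu * k - lam%:Z * l).
    split; last by rewrite a2E a3E !PoszM; ring.
    rewrite hb1 b3E !PoszM.
    transitivity (a1%:Z * k * (lam%:Z * a2'%:Z + mu * a3'%:Z)); last by ring.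
    by rewrite -bezout mulr1.
  exists (lam%:Z * k + a3'%:Z * l), (mu * k - a2'%:Z * l).
  split; first by rewrite hb1 b3E !PoszM; ring.
  by rewrite {1}muE a2E a3E !PoszM; ring.
have M_b v : M v <-> inIntSpan [tuple zvec b1%:Z b2%:Z; zvec b3%:Z 0] v.
  rewrite (zvec_coord v) inIntSpan_zvec Mb.
  by split=> -[k [l [-> ->]]]; exists k, l; rewrite mul0r addr0.
have b3_gt0 : (0 < b3)%N by lia.
have a3_gt0 : (0 < a3)%N by lia.
have Mp : M (zvec b3%:Z 0) by apply/Mb; exists 0, 1; split; ring.
have Mq : M (zvec 0 a3%:Z) by apply/Ma; exists 0, 1; split; ring.
have satS le (leT : term_order le) := saturated_corners M0 MB b3_gt0 a3_gt0 Mp Mq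
  (standard_order_ideal leT) (standard_compatible M0 MB leT)
  (fun c _ => standard_exists M0 MB b3_gt0 a3_gt0 Mp Mq c leT).
have stdP le (leT : term_order le) m :=
  standard_exists M0 MB b3_gt0 a3_gt0 Mp Mq m leT.
have twoR := @two_corners_reduced M M0 MB _ _ b3_gt0 a3_gt0 Mp Mq K.
have threeR := @three_corners_reduced M M0 MB _ _ b3_gt0 a3_gt0 Mp Mq K.
have irrE le G : term_order le -> groebner_basis le G I ->
    irreducible_monomial le G = standard M le.
  move=> leT gbG; apply: functional_extensionality => m.
  apply: propositional_extensionality.
  exact: (irreducible_monomialP M0 MB leT m gbG).
set e := ((a3 - a2) %% a3)%N.
set f := ((b3 - b1) %% b3)%N.
have e_lt : (e < a3)%N by rewrite ltn_mod.
have f_lt : (f < b3)%N by rewrite ltn_mod.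
have eM : M (zvec a1%:Z (- e%:Z)).
  apply/Ma; exists 1, (((a3 - a2) %/ a3)%N%:Z - 1); split; first by rewrite mulr1.
  by have := divn_eq (a3 - a2) a3; rewrite -/e; lia.
have fM : M (zvec (- f%:Z) b2%:Z).
  apply/Mb; exists 1, (((b3 - b1) %/ b3)%N%:Z - 1); split; last by rewrite mulr1.
  by have := divn_eq (b3 - b1) b3; rewrite -/f; lia.
have G1E : G1 = [fset monomial K a1 0 - monomial K 0 e;
                      monomial K 0 a3 - monomial K 0 0]%fset.
  rewrite monomial00; reflexivity.
have G2E : G2 = [fset monomial K b3 0 - monomial K 0 0;
                      monomial K 0 b2 - monomial K f 0]%fset.
  rewrite monomial00; reflexivity.
clearbody G1 G2.
have twoE a a' b b' O : compatible M O -> (a' < b)%N -> (b' < a)%N ->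
    congruent M (npoint a 0) (npoint 0 a') ->
    congruent M (npoint 0 b) (npoint b' 0) ->
    two_corners O a a' b b' ->
    [fset monomial K a 0 - monomial K 0 a';
          monomial K 0 b - monomial K b' 0]%fset = G1 \/
    [fset monomial K a 0 - monomial K 0 a';
          monomial K 0 b - monomial K b' 0]%fset = G2.
  move=> compO a'b b'a aa' bb' cO.
  have [[-> -> -> ->]|[-> -> -> ->]] := two_corners_unique MB Ma Mb ha1 b2_gt0
      e_lt f_lt eM fM compO a'b b'a aa' bb' cO.
    by left; rewrite G1E; reflexivity.
  by right; rewrite G2E; reflexivity.
split; first by split.
- move=> O; split=> [maxO|[le [G [leT gbG OE]]]].
    have [le leT OE] := maximal_compatible_standard M0 MB b3_gt0 a3_gt0 Mp Mq maxO.
    have [G redG] := reduced_groebner_basis_exists M0 MB b3_gt0 a3_gt0 Mp Mq K leT.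
    have [gbG _ _] := redG.
    by exists le, G; split=> // m; rewrite irrE // OE.
  have -> : O = standard M le.
    apply: functional_extensionality => m.
    by apply: propositional_extensionality; rewrite OE irrE.
  exact: (standard_maximal_compatible M0 MB leT (stdP le leT)).
- move=> G; split=> [[[le [leT redG]] G2c]|].
    have [a [a' [b [b' [[[a'b b'a] sa' sb' aa' bb'] cO]]]]] := satS le leT.
    case: cO => [cO|[c1 [c2 [c1_gt0 c2_gt0 cM cornE]]]].
      rewrite (proj1 (twoR le leT _ _ _ _ sa' sb' aa' bb' G cO.1) redG).
      by apply: twoE cO => //; exact: standard_compatible.
    move: G2c.
    rewrite (proj1 (threeR le leT _ _ _ _ sa' sb' aa' bb' _ _ G cM cornE) redG).
    by rewrite card_three_corners.
  move=> [->|->].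
    rewrite G1E card_two_corners //; split=> //.
    apply: (box_reduced M0 MB b3_gt0 a3_gt0 Mp Mq K e_lt ha1 eM) (a_box_trivial Ma).
    by apply: zvec_congr Mq _ _; lia.
  rewrite G2E card_two_corners //; split=> //.
  apply: (box_reduced M0 MB b3_gt0 a3_gt0 Mp Mq K b2_gt0 f_lt _ fM) (b_box_trivial Mb).
  by apply: zvec_congr Mp _ _; lia.
- split=> [G12|a20].
    have : monomial K 0 a3 - monomial K 0 0 \in G2.
      by rewrite -G12 G1E in_fset2 eqxx orbT.
    have b2a3 : (b2 <= a3)%N by apply: dvdn_leq => //; rewrite hb2 dvdn_gcdr.
    rewrite G2E in_fset2 => /orP[]/eqP /(congr1 (mcoeff (npoint 0 a3)));
      rewrite !mcoeffB !mcoeffX !npoint_eq !eqxx.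
      by rewrite !(ltn_eqF a3_gt0) !andbF !subr0 => /eqP; rewrite oner_eq0.
    rewrite !(ltn_eqF a3_gt0) !andbF !subr0 /=; case: eqP => [b2E _|_ /eqP];
      last by rewrite oner_eq0.
    have : (a3 %| a2)%N by rewrite -b2E hb2 dvdn_gcdl.
    by case: (posnP a2) => // a2_gt0 /(dvdn_leq a2_gt0); lia.
  have b2E : b2 = a3 by rewrite hb2 a20 gcd0n.
  have lam0 : lam = 0%N.
    by apply/eqP; rewrite -leqn0; apply: lam_min; exists 1; rewrite b2E; ring.
  have b3a1 : b3 = a1 by rewrite hb3 b2E mulnK.
  have b10 : b1 = 0%N by rewrite hb1 lam0 muln0.
  rewrite G1E G2E /e /f a20 b10 !subn0 !modnn b2E b3a1; reflexivity.
- move=> le G leT redG nG1 nG2.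
  have [gbG _ _] := redG; rewrite irrE //.
  have [a [a' [b [b' [[[a'b b'a] sa' sb' aa' bb'] cO]]]]] := satS le leT.
  case: cO => [cO|[c1 [c2 [c1_gt0 c2_gt0 cM cornE]]]].
    have GE := proj1 (twoR le leT _ _ _ _ sa' sb' aa' bb' G cO.1) redG.
    have [|E|E] := twoE _ _ _ _ _ _ a'b b'a aa' bb' cO; first exact: standard_compatible.
      by case: nG1; rewrite GE.
    by case: nG2; rewrite GE.
  have GE := proj1 (threeR le leT _ _ _ _ sa' sb' aa' bb' _ _ G cM cornE) redG.
  rewrite {1}GE card_three_corners //; split=> //.
  exists a, a', b, b', c1, c2; split=> //.
    exact: (standard_maximal_compatible M0 MB leT (stdP le leT)).
  split=> //; rewrite /= !inE !npoint_eq; lia.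
Qed.
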